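(* Let $n\ge 3$, let $q_1,\dots,q_n\in\mathbb{H}$ with $q_1\neq 0$, put $q_0=0$, let $v_j=q_jq_n-q_{j-1}$ for $j=1,\dots,n$, and put $v_{n+1}=0$. Let $$f_{r_1}(z)=z^{n+1}-z^{n-1}v_n-z^{n-2}v_{n-1}-\cdots-zv_2-v_1$$ and $$\gamma=|v_1v_n|^2+|v_2v_n|^2+\sum_{j=1}^{n-1}\left|v_j+v_{j+2}v_n\right|^2.$$ Then every zero $z\in\mathbb{H}$ of $f_{r_1}$ satisfies $$|z|\le\left(1+\gamma+2\sum_{j=1}^{n}|v_j|^2\right)^{1/6}.$$
   Context: $\mathbb{H}$ is the real quaternion division algebra, and $|a+bi+cj+dk|=\sqrt{a^2+b^2+c^2+d^2}$. The quaternions $q_1,\dots,q_n$ are the coefficients of the monic polynomial $f_r(z)=z^n+z^{n-1}q_n+\cdots+zq_2+q_1$, from which $f_{r_1}$ is constructed. Polynomials have their coefficients written on the right of the powers of $z$; a zero of $f_{r_1}$ is a quaternion $z$ with $z^{n+1}-z^{n-1}v_n-\cdots-zv_2-v_1=0$ (direct evaluation in $\mathbb{H}$). *)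

(* Defs.v *)
From HB Require Import structures.
From mathcomp Require Import all_boot all_order all_algebra ring.
From mathcomp Require Import reals exp.
Set Implicit Arguments.
Unset Strict Implicit.
Unset Printing Implicit Defensive.
Import Order.TTheory GRing.Theory Num.Theory.
Local Open Scope ring_scope.

(* [Quat a b c d] is a + b i + c j + d k. *)
Record quat (R : Type) := Quat { qre : R; qi : R; qj : R; qk : R }.

Definition prod_of_quat (R : Type) (x : quat R) : R * R * R * R :=
  (qre x, qi x, qj x, qk x).
Definition quat_of_prod (R : Type) (x : R * R * R * R) : quat R :=
  let: (a, b, c, d) := x in Quat a b c d.

Lemma prod_of_quatK (R : Type) :
  cancel (@prod_of_quat R) (@quat_of_prod R).
Proof. by case. Qed.

HB.instance Definition _ (R : eqType) :=
  Equality.copy (quat R) (can_type (@prod_of_quatK R)).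
HB.instance Definition _ (R : choiceType) :=
  Choice.copy (quat R) (can_type (@prod_of_quatK R)).

Section QuaternionRing.
Variable R : comNzRingType.

Definition addq (x y : quat R) : quat R :=
  Quat (qre x + qre y) (qi x + qi y) (qj x + qj y) (qk x + qk y).

Definition oppq (x : quat R) : quat R :=
  Quat (- qre x) (- qi x) (- qj x) (- qk x).

(* i^2 = j^2 = k^2 = ijk = -1 *)
Definition mulq (x y : quat R) : quat R :=
  Quat (qre x * qre y - qi x * qi y - qj x * qj y - qk x * qk y)
       (qre x * qi y + qi x * qre y + qj x * qk y - qk x * qj y)
       (qre x * qj y - qi x * qk y + qj x * qre y + qk x * qi y)
       (qre x * qk y + qi x * qj y - qj x * qi y + qk x * qre y).

Lemma addqA : associative addq.
Proof. by move=> x y z; rewrite /addq /= !addrA. Qed.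
Lemma addqC : commutative addq.
Proof. by move=> x y; rewrite /addq; congr Quat; rewrite addrC. Qed.
Lemma add0q : left_id (Quat 0 0 0 0) addq.
Proof. by case=> a b c d; rewrite /addq /= !add0r. Qed.
Lemma addNq : left_inverse (Quat 0 0 0 0) oppq addq.
Proof. by move=> x; rewrite /addq /= !addNr. Qed.

HB.instance Definition _ :=
  GRing.isZmodule.Build (quat R) addqA addqC add0q addNq.

Lemma mulqA : associative mulq.
Proof. by move=> x y z; rewrite /mulq /=; congr Quat; ring. Qed.
Lemma mul1q : left_id (Quat 1 0 0 0) mulq.
Proof. by case=> a b c d; rewrite /mulq /=; congr Quat; ring. Qed.
Lemma mulq1 : right_id (Quat 1 0 0 0) mulq.
Proof. by case=> a b c d; rewrite /mulq /=; congr Quat; ring. Qed.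
Lemma mulqDl : left_distributive mulq addq.
Proof. by move=> x y z; rewrite /mulq /addq /=; congr Quat; ring. Qed.
Lemma mulqDr : right_distributive mulq addq.
Proof. by move=> x y z; rewrite /mulq /addq /=; congr Quat; ring. Qed.
Lemma oneq_neq0 : Quat 1 0 0 0 != 0 :> quat R.
Proof. by apply/eqP => -[] /eqP; rewrite oner_eq0. Qed.

HB.instance Definition _ :=
  GRing.Zmodule_isNzRing.Build (quat R)
    mulqA mul1q mulq1 mulqDl mulqDr oneq_neq0.

End QuaternionRing.

Definition qnorm (R : rcfType) (x : quat R) : R :=
  Num.sqrt (qre x ^+ 2 + qi x ^+ 2 + qj x ^+ 2 + qk x ^+ 2).

(* The value at [z] of z^(n+1) - z^(n-1) v_n - ... - z v_2 - v_1, with the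
   coefficients multiplied on the right of the powers of [z]; mathcomp's [horner]
   puts them on the left, which differs over a noncommutative ring. *)
Definition fr1 (R : rcfType) (n : nat) (v : nat -> quat R) (z : quat R) :
    quat R :=
  z ^+ n.+1 - \sum_(1 <= j < n.+1) z ^+ j.-1 * v j.

Definition gamma (R : rcfType) (n : nat) (v : nat -> quat R) : R :=
  qnorm (v 1%N * v n) ^+ 2 + qnorm (v 2%N * v n) ^+ 2 +
  \sum_(1 <= j < n) qnorm (v j + v j.+2 * v n) ^+ 2.

(* Main.v *)
Require Import Defs.
From HB Require Import structures.
From mathcomp Require Import all_boot all_order all_algebra.
From mathcomp Require Import reals exp.
From mathcomp Require Import ring lra.
Import Order.TTheory GRing.Theory Num.Theory.
Local Open Scope ring_scope.

(** Let [w = (1, z, ..., z^n)].  Left multiplication by [z^3] shifts [w] to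
    [(z^3, ..., z^n, z^(n+1), z^(n+2), z^(n+3))].  When [z] is a zero, each of
    the last three entries is again a combination of the entries of [w] with
    coefficients on the right: one reduction of [z^(n+1)] and multiplication by
    [z] give the coefficient vectors [(v_1, ..., v_n, 0)] and
    [(0, v_1, ..., v_n)], since [z^n] does not occur in the reduction, and one
    more multiplication by [z] reduces [z^(n+1) v_n] once more and gives the
    vector whose squared length is [gamma].  (In other words, [w] is a left
    eigenvector of the cube of the companion matrix.)  As the quaternion norm is
    multiplicative, Cauchy-Schwarz ([qnorm_sum_CauchySchwarz]) bounds the
    squared norms of these three entries, while the first [n - 2] entries
    contribute at most [|w|^2].  Hence
    [|z|^6 |w|^2 <= (1 + gamma + 2 sum |v_j|^2) |w|^2], and [|w|^2 >= 1]
    cancels. *)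

Lemma sqr_qnorm (R : rcfType) (x : quat R) :
  qnorm x ^+ 2 = qre x ^+ 2 + qi x ^+ 2 + qj x ^+ 2 + qk x ^+ 2.
Proof. by rewrite /qnorm sqr_sqrtr // !addr_ge0 ?sqr_ge0. Qed.

Lemma qnorm_ge0 (R : rcfType) (x : quat R) : 0 <= qnorm x.
Proof. exact: sqrtr_ge0. Qed.

Lemma qnorm0 (R : rcfType) : qnorm (0 : quat R) = 0.
Proof. by rewrite /qnorm /= !expr0n /= !addr0 sqrtr0. Qed.

Lemma qnorm1 (R : rcfType) : qnorm (1 : quat R) = 1.
Proof. by rewrite /qnorm /= !expr0n /= !addr0 expr1n sqrtr1. Qed.

(** Euler's four-square identity. *)
Lemma qnormM (R : rcfType) (x y : quat R) :
  qnorm (x * y) = qnorm x * qnorm y.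
Proof.
apply/eqP; rewrite -(@eqrXn2 _ 2) ?mulr_ge0 ?qnorm_ge0 //; apply/eqP.
by rewrite exprMn !sqr_qnorm /=; ring.
Qed.

Lemma qnormX (R : rcfType) (x : quat R) (k : nat) :
  qnorm (x ^+ k) = qnorm x ^+ k.
Proof.
by elim: k => [|k IH]; rewrite ?expr0 ?qnorm1 // !exprS qnormM IH.
Qed.

(** The induction step of the Cauchy-Schwarz inequality: [a] is the partial sum
    and [P], [Q] bound its two factors.  The cross term is controlled by
    Cauchy-Schwarz in four real coordinates, followed by the
    arithmetic-geometric mean inequality. *)
Lemma qnorm_CauchySchwarz_step (R : rcfType) (a x y : quat R) (P Q : R) :
  0 <= P -> 0 <= Q -> qnorm a ^+ 2 <= P * Q ->
  qnorm (x * y + a) ^+ 2 <= (qnorm x ^+ 2 + P) * (qnorm y ^+ 2 + Q).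
Proof.
move=> P0 Q0 aPQ.
have := congr1 (fun r => r ^+ 2) (qnormM R x y).
rewrite exprMn; move: (x * y) => b NbE.
pose d := qre a * qre b + qi a * qi b + qj a * qj b + qk a * qk b.
have addE : qnorm (b + a) ^+ 2 = qnorm a ^+ 2 + qnorm b ^+ 2 + 2 * d.
  by rewrite !sqr_qnorm /= /d; ring.
have d2 : d ^+ 2 <= qnorm a ^+ 2 * qnorm b ^+ 2.
  rewrite -subr_ge0 !sqr_qnorm.
  (* Lagrange's identity *)
  have -> : (qre a ^+ 2 + qi a ^+ 2 + qj a ^+ 2 + qk a ^+ 2) *
      (qre b ^+ 2 + qi b ^+ 2 + qj b ^+ 2 + qk b ^+ 2) - d ^+ 2 =
      (qre a * qi b - qi a * qre b) ^+ 2 + (qre a * qj b - qj a * qre b) ^+ 2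
    + (qre a * qk b - qk a * qre b) ^+ 2 + (qi a * qj b - qj a * qi b) ^+ 2
    + (qi a * qk b - qk a * qi b) ^+ 2 + (qj a * qk b - qk a * qj b) ^+ 2.
    by rewrite /d; ring.
  by rewrite !addr_ge0 ?sqr_ge0.
move: NbE addE d2 aPQ (sqr_ge0 (qnorm x)) (sqr_ge0 (qnorm y)).
move: (qnorm (b + a) ^+ 2) (qnorm a ^+ 2) (qnorm b ^+ 2).
move: (qnorm x ^+ 2) (qnorm y ^+ 2) => X Y Nab Na Nb -> -> d2 aPQ X0 Y0.
have dle : 2 * d <= P * Y + Q * X.
  have s0 : 0 <= P * Y + Q * X by rewrite addr_ge0 ?mulr_ge0.
  apply: le_trans (ler_norm _) _.
  rewrite -(@ler_pXn2r _ 2) ?nnegrE ?normr_ge0 // real_normK ?num_real //.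
  have h : Na * (X * Y) <= P * Q * (X * Y) by rewrite ler_wpM2r ?mulr_ge0.
  have h2 := sqr_ge0 (P * Y - Q * X).
  lra.
lra.
Qed.

Lemma qnorm_sum_CauchySchwarz (R : rcfType) (I : Type) (r : seq I)
    (x y : I -> quat R) :
  qnorm (\sum_(i <- r) x i * y i) ^+ 2 <=
    (\sum_(i <- r) qnorm (x i) ^+ 2) * (\sum_(i <- r) qnorm (y i) ^+ 2).
Proof.
elim: r => [|i r IH]; first by rewrite !big_nil qnorm0 expr0n mul0r.
rewrite !big_cons; apply: qnorm_CauchySchwarz_step => //.
  by apply: sumr_ge0 => j _; rewrite sqr_ge0.
by apply: sumr_ge0 => j _; rewrite sqr_ge0.
Qed.

Section Reduction.
Variables (R : rcfType) (n : nat) (v : nat -> quat R) (z : quat R).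
Hypotheses (n_gt0 : (0 < n)%N) (hvS : v n.+1 = 0) (hz : fr1 n v z = 0).

Lemma zero_expS : z ^+ n.+1 = \sum_(0 <= k < n.+1) z ^+ k * v k.+1.
Proof.
move/eqP: hz; rewrite /fr1 subr_eq0 => /eqP ->.
by rewrite big_add1 /= big_nat_recr //= hvS mulr0 addr0.
Qed.

Lemma zero_expSS : z ^+ n.+2 = \sum_(1 <= k < n.+1) z ^+ k * v k.
Proof.
rewrite exprS zero_expS big_nat_recr //= hvS mulr0 addr0 mulr_sumr big_add1 /=.
by apply: eq_bigr => k _; rewrite mulrA -exprS.
Qed.

(** The coefficients of [z^(n+3)].  For [k >= 2], the term [v_(k-1)] is the
    shifted coefficient of [z^(n+2)]; the products with [v_n] come from reducing
    the top term [z^(n+1) v_n] of the shift. *)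
Definition cube_coef (k : nat) : quat R :=
  if k is j.+2 then v j.+1 + v j.+3 * v n else v k.+1 * v n.

Lemma zero_expSSS : z ^+ n.+3 = \sum_(0 <= k < n.+1) z ^+ k * cube_coef k.
Proof.
have shift : z ^+ n.+3 =
    \sum_(2 <= k < n.+1) z ^+ k * v k.-1 + z ^+ n.+1 * v n.
  rewrite exprS zero_expSS mulr_sumr big_nat_recr //=.
  rewrite mulrA -exprS; congr (_ + _); rewrite [RHS]big_add1.
  by apply: eq_bigr => k _; rewrite mulrA -exprS.
rewrite shift zero_expS mulr_suml.
rewrite (@big_ltn _ _ _ 0%N) // (@big_ltn _ _ _ 1%N) //.
rewrite [RHS](@big_ltn _ _ _ 0%N) // [X in _ = _ + X](@big_ltn _ _ _ 1%N) //.
rewrite addrCA [X in _ + X = _]addrCA !mulrA; congr (_ + (_ + _)).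
rewrite -big_split /=; apply: eq_big_nat => -[|[|k]] // _.
by rewrite mulrDr !mulrA.
Qed.

Lemma sum_cube_coef :
  \sum_(0 <= k < n.+1) qnorm (cube_coef k) ^+ 2 = gamma n v.
Proof.
rewrite big_ltn // big_ltn // /gamma addrA; congr (_ + _).
by rewrite !big_add1.
Qed.

Lemma sum_sqr_qnorm_coef :
  \sum_(0 <= k < n.+1) qnorm (v k.+1) ^+ 2 =
    \sum_(1 <= j < n.+1) qnorm (v j) ^+ 2.
Proof. by rewrite big_nat_recr //= hvS qnorm0 expr0n addr0 big_add1. Qed.

Lemma qnorm_zero_exp6 :
  (2 <= n)%N ->
  qnorm z ^+ 6 <= 1 + gamma n v + 2 * \sum_(1 <= j < n.+1) qnorm (v j) ^+ 2.
Proof.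
move=> n2; set V := \sum_(1 <= j < n.+1) _.
pose W := \sum_(0 <= k < n.+1) qnorm (z ^+ k) ^+ 2.
have ge0 (m1 m2 : nat) : 0 <= \sum_(m1 <= k < m2) qnorm (z ^+ k) ^+ 2.
  by apply: sumr_ge0 => k _; rewrite sqr_ge0.
have W_ge1 : 1 <= W.
  by rewrite /W big_ltn // expr0 qnorm1 expr1n lerDl.
have V0 : 0 <= V by apply: sumr_ge0 => k _; rewrite sqr_ge0.
have W_tail (m : nat) : (m <= n.+1)%N ->
    \sum_(m <= k < n.+1) qnorm (z ^+ k) ^+ 2 <= W.
  by move=> mn; rewrite /W (@big_cat_nat _ _ _ m 0%N) //= lerDr.
have e1 : qnorm (z ^+ n.+1) ^+ 2 <= W * V.
  by rewrite /V -sum_sqr_qnorm_coef zero_expS qnorm_sum_CauchySchwarz.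
have e2 : qnorm (z ^+ n.+2) ^+ 2 <= W * V.
  rewrite zero_expSS; apply: le_trans (qnorm_sum_CauchySchwarz _ _ _ _ _) _.
  by rewrite ler_wpM2r // W_tail.
have e3 : qnorm (z ^+ n.+3) ^+ 2 <= W * gamma n v.
  by rewrite -sum_cube_coef zero_expSSS qnorm_sum_CauchySchwarz.
have shift : qnorm z ^+ 6 * W = \sum_(3 <= k < n.+1) qnorm (z ^+ k) ^+ 2
    + qnorm (z ^+ n.+1) ^+ 2 + qnorm (z ^+ n.+2) ^+ 2 + qnorm (z ^+ n.+3) ^+ 2.
  rewrite -!big_nat_recr ?ltnS ?leqW //= !big_add1 /= mulr_sumr.
  by apply: eq_bigr => k _; rewrite !qnormX -!exprM -exprD !mulSn !addnA.
have W_gt0 : 0 < W by apply: lt_le_trans W_ge1.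
have tail3 := W_tail 3%N n2.
rewrite -(ler_pM2r W_gt0) shift.
lra.
Qed.

End Reduction.

Theorem theorem4 (R : realType) (n : nat) (q v : nat -> quat R)
  (hn : (3 <= n)%N)
  (hq1 : q 1%N != 0)
  (hq0 : q 0%N = 0)
  (hv : forall j : nat, (1 <= j <= n)%N -> v j = q j * q n - q j.-1)
  (hvS : v n.+1 = 0)
  (z : quat R) (hz : fr1 n v z = 0) :
  qnorm z <=
    (1 + gamma n v + 2 * \sum_(1 <= j < n.+1) qnorm (v j) ^+ 2) `^ (6^-1).
Proof.
have n2 : (2 <= n)%N := ltnW hn.
have le6 := @qnorm_zero_exp6 R n v z (ltnW n2) hvS hz n2.
have z6 : 0 <= qnorm z ^+ 6 by rewrite exprn_ge0 ?qnorm_ge0.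
have -> : qnorm z = (qnorm z ^+ 6) `^ (6^-1).
  by rewrite -powR_mulrn ?qnorm_ge0 // -powRrM divff ?pnatr_eq0 // powRr1 ?qnorm_ge0.
by apply: ge0_ler_powR; rewrite ?nnegrE ?invr_ge0 // (le_trans z6).
Qed.
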